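(* If $A\in M_k\otimes M_m$ is a positive semidefinite Hermitian matrix with tensor rank $2$, then $A$ has a minimal separable decomposition, i.e. $A=C_1\otimes D_1+C_2\otimes D_2$ with $C_1,C_2\in M_k$ and $D_1,D_2\in M_m$ positive semidefinite Hermitian matrices such that $\{C_1,C_2\}$ and $\{D_1,D_2\}$ are linearly independent sets. Therefore $A$ is separable.
   Context: $M_k$ denotes the complex $k\times k$ matrices, and $M_k\otimes M_m$ is identified with $M_{km}$ via the Kronecker product. The tensor rank of $A\in M_k\otimes M_m$ is the minimal number of elementary tensors $X\otimes Y$ ($X\in M_k$, $Y\in M_m$) whose sum is $A$. $A\in M_k\otimes M_m$ is separable if $A=\sum_{i=1}^n C_i\otimes D_i$ with $C_i\in M_k$ and $D_i\in M_m$ positive semidefinite Hermitian for every $i$ (a separable decomposition). A decomposition $\sum_{i=1}^n A_i\otimes B_i$ is minimal if $\{A_1,\dots,A_n\}$ and $\{B_1,\dots,B_n\}$ are linearly independent sets. *)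

(* Defs.v *)
From mathcomp Require Import all_boot all_order all_algebra.
From mathcomp Require Import sesquilinear spectral.
From mathcomp Require Export complex mxtens.
From mathcomp Require Import reals.

Set Implicit Arguments.
Unset Strict Implicit.
Unset Printing Implicit Defensive.

Import Order.TTheory GRing.Theory Num.Theory.
Local Open Scope ring_scope.
Local Open Scope sesquilinear_scope.

(* The order on [R[i]] is partial: [0 <= z] says that [z] is real and
   nonnegative. *)
Definition psdmx (R : realType) (n : nat) (A : 'M[R[i]]_n) : Prop :=
  A \is hermsymmx /\ forall v : 'cV[R[i]]_n, 0 <= (v ^t* *m A *m v) 0 0.

(* [A *t B] is the Kronecker product, so that ['M_k] tensor ['M_m] is
   ['M_(k * m)]. *)
Definition tensor_decomposition (R : realType) (k m n : nat)
    (A : 'M[R[i]]_(k * m)) (X : 'I_n -> 'M[R[i]]_k) (Y : 'I_n -> 'M[R[i]]_m) :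
    Prop :=
  A = \sum_(i < n) X i *t Y i.

Definition has_tensor_rank (R : realType) (k m : nat)
    (A : 'M[R[i]]_(k * m)) (r : nat) : Prop :=
  (exists (X : 'I_r -> 'M[R[i]]_k) (Y : 'I_r -> 'M[R[i]]_m),
      tensor_decomposition A X Y) /\
  (forall (n : nat) (X : 'I_n -> 'M[R[i]]_k) (Y : 'I_n -> 'M[R[i]]_m),
      tensor_decomposition A X Y -> (r <= n)%N).

Definition separable (R : realType) (k m : nat) (A : 'M[R[i]]_(k * m)) : Prop :=
  exists (n : nat) (C : 'I_n -> 'M[R[i]]_k) (D : 'I_n -> 'M[R[i]]_m),
    tensor_decomposition A C D /\ forall i, psdmx (C i) /\ psdmx (D i).

(* Main.v *)
(* Let [G] be the partial trace of [A] over the first factor: it is psd, nonzero,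
   and lies in the span of the second factors of a rank 2 decomposition.
   Completing it to a hermitian basis [G, H] of that span gives
   [A = X1 *t G + X2 *t H] with [X1, X2] hermitian and [X2] traceless, so that
   [v^* X2 v] takes both signs.  Testing [A] on product vectors,
   [(v^* X1 v) (w^* G w) + (v^* X2 v) (w^* H w) >= 0]; so if [b] and [a] are the
   least reals with [- a G <= H <= b G], then [X1 + b X2] and [X1 - a X2] are
   psd, and [A] is the sum of [(X1 + b X2) *t (H + a G)] and
   [(X1 - a X2) *t (b G - H)], divided by [a + b]. *)
Require Import Defs.
From mathcomp Require Import all_boot all_order all_algebra.
From mathcomp Require Import sesquilinear spectral.
From mathcomp Require Import complex mxtens classical_sets boolp reals.
From mathcomp Require Import ring lra.

Set Implicit Arguments.
Unset Strict Implicit.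
Unset Printing Implicit Defensive.

Import Order.TTheory GRing.Theory Num.Theory.
Local Open Scope ring_scope.
Local Open Scope sesquilinear_scope.

(** * A separating slope for two pairs of real functions *)

(** Take [b] to be the infimum of the slopes [s] with [q2 <= s * q1] everywhere. Each [v] with
    [p2 v < 0] makes [- p1 v / p2 v] such a slope, hence an upper bound of [b]; where [p2 v >= 0],
    testing on one [w] with [q1 w > 0] suffices. *)
Lemma separating_slope (R : realType) (V W : Type) (p1 p2 : V -> R)
    (q1 q2 : W -> R) :
  (forall w, 0 <= q1 w) -> (exists w, 0 < q1 w) ->
  (forall v w, 0 <= p1 v * q1 w + p2 v * q2 w) -> (exists v, p2 v < 0) ->
  exists b, (forall w, q2 w <= b * q1 w) /\ (forall v, 0 <= p1 v + b * p2 v).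
Proof.
move=> q1_ge0 [w0 q1w0] pq [v0 p2v0].
pose S : set R := [set s | forall w, q2 w <= s * q1 w]%classic.
have memS v : p2 v < 0 -> S (- p1 v / p2 v).
  move=> p2v w; rewrite -(ler_nM2l p2v) mulrA (mulrC (p2 v)) divfK ?lt_eqF //.
  by have := pq v w; lra.
have lbS w : 0 < q1 w -> lbound S (q2 w / q1 w).
  by move=> q1w s /(_ w) Ss; rewrite ler_pdivrMr.
have S0 : nonempty S by exists (- p1 v0 / p2 v0); apply: memS.
have hlS : has_lbound S by exists (q2 w0 / q1 w0); apply: lbS.
have q2le w : q2 w <= inf S * q1 w.
  have [q1w|] := ltP 0 (q1 w).
    by rewrite -ler_pdivrMr //; apply: lb_le_inf => //; apply: lbS.
  (* Where [q1 w = 0] there is no quotient to compare; any member of [S] gives [q2 w <= 0]. *)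
  move=> q1w; have {q1w} q1w : q1 w = 0 by apply/eqP; rewrite eq_le q1w q1_ge0.
  by rewrite q1w mulr0; case: S0 => s /(_ w); rewrite q1w mulr0.
exists (inf S); split=> // v.
have [p2v|p2v] := ltP (p2 v) 0.
  have := ge_inf hlS (memS v p2v).
  by rewrite ler_ndivlMr // -subr_ge0; lra.
rewrite -(pmulr_lge0 _ q1w0).
have := ler_wpM2l p2v (q2le w0); have := pq v w0; lra.
Qed.

(** * Quadratic forms of hermitian and psd matrices *)

Section Hermitian.
Variables (R : realType).
Local Notation C := R[i].

Definition quad n (M : 'M[C]_n) (v : 'cV[C]_n) : C := (v^t* *m M *m v) 0 0.

Lemma hermsymmxP n (M : 'M[C]_n) : reflect (M^t* = M) (M \is hermsymmx).
Proof.
apply: (iffP eqP); rewrite expr0 scale1r => e; first by rewrite -e.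
by rewrite e.
Qed.

Lemma trmxCD m n (M N : 'M[C]_(m, n)) : (M + N)^t* = M^t* + N^t*.
Proof. by rewrite linearD map_mxD. Qed.

Lemma trmxCN m n (M : 'M[C]_(m, n)) : (- M)^t* = - M^t*.
Proof. by rewrite linearN map_mxN. Qed.

Lemma trmxCZ m n (c : C) (M : 'M[C]_(m, n)) : (c *: M)^t* = c^* *: M^t*.
Proof. by rewrite linearZ /= map_mxZ. Qed.

Lemma trmxC_tens m n p q (M : 'M[C]_(m, n)) (N : 'M[C]_(p, q)) :
  (M *t N)^t* = M^t* *t N^t*.
Proof. by rewrite trmx_tens map_mxT. Qed.

Lemma quadD n (M N : 'M[C]_n) v : quad (M + N) v = quad M v + quad N v.
Proof. by rewrite /quad mulmxDr mulmxDl mxE. Qed.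

Lemma quadZ n c (M : 'M[C]_n) v : quad (c *: M) v = c * quad M v.
Proof. by rewrite /quad -scalemxAr -scalemxAl mxE. Qed.

Lemma quad_sum n I (r : seq I) (M : I -> 'M[C]_n) v :
  quad (\sum_(i <- r) M i) v = \sum_(i <- r) quad (M i) v.
Proof. by rewrite /quad mulmx_sumr mulmx_suml summxE. Qed.

Lemma quad_tens k m (X : 'M[C]_k) (Y : 'M[C]_m)
    (v : 'cV[C]_k) (w : 'cV[C]_m) :
  quad (X *t Y) (v *t w) = quad X v * quad Y w.
Proof.
(* The only index of a matrix of size [1 * 1], written as a pair so that [tensmxE] applies. *)
pose o : 'I_(1 * 1) := mxtens_index (0, 0).
have -> : quad (X *t Y) (v *t w) = ((v *t w)^t* *m (X *t Y) *m (v *t w)) o o.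
  by rewrite /quad; congr (fun_of_matrix _ _ _); apply: val_inj.
by rewrite trmxC_tens !tensmx_mul tensmxE.
Qed.

Lemma quad_delta n (M : 'M[C]_n) i : quad M (delta_mx i 0) = M i i.
Proof.
by rewrite /quad trmx_delta map_delta_mx -rowE -colE !mxE.
Qed.

Lemma quad_real n (M : 'M[C]_n) v : M \is hermsymmx -> quad M v \is Num.real.
Proof.
move=> /hermsymmxP hM; apply/CrealP.
have -> : (quad M v)^* = ((v^t* *m M *m v)^t*) 0 0 by rewrite /quad !mxE.
by rewrite !trmx_mul !map_mxM /= trmxCK hM mulmxA.
Qed.

Lemma quad_Re n (M : 'M[C]_n) v :
  M \is hermsymmx -> (complex.Re (quad M v))%:C%C = quad M v.
Proof. by move=> hM; apply: RRe_real; apply: quad_real. Qed.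

Lemma Re_quadZ n (M : 'M[C]_n) c v :
  complex.Re (quad (c%:C%C *: M) v) = c * complex.Re (quad M v).
Proof. by rewrite quadZ; case: (quad M v) => x y /=; rewrite mul0r subr0. Qed.

Lemma Re_quadD n (M N : 'M[C]_n) v :
  complex.Re (quad (M + N) v) = complex.Re (quad M v) + complex.Re (quad N v).
Proof. by rewrite quadD; case: (quad M v) (quad N v) => [x y] [z t]. Qed.

Lemma hermD n (M N : 'M[C]_n) :
  M \is hermsymmx -> N \is hermsymmx -> M + N \is hermsymmx.
Proof.
by move=> /hermsymmxP hM /hermsymmxP hN; apply/hermsymmxP; rewrite trmxCD hM hN.
Qed.

Lemma hermZ n (c : R) (M : 'M[C]_n) :
  M \is hermsymmx -> c%:C%C *: M \is hermsymmx.
Proof.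
move=> /hermsymmxP hM; apply/hermsymmxP; rewrite trmxCZ hM.
by rewrite -[_^*]/((c%:C)^*)%C conjc_real.
Qed.

(** Forms of hermitian matrices are real, so positivity can be tested in [R], where the order is
    total and infima exist. *)
Lemma psdmxP n (M : 'M[C]_n) :
  psdmx M <-> M \is hermsymmx /\ forall v, 0 <= complex.Re (quad M v).
Proof.
split=> -[hM pM]; split=> // v.
  by rewrite -ler0c quad_Re //; apply: pM.
by have := pM v; rewrite -ler0c quad_Re.
Qed.

Lemma psdmx_diag_ge0 n (M : 'M[C]_n) i : psdmx M -> 0 <= M i i.
Proof. by case=> _ /(_ (delta_mx i 0)); rewrite -/(quad _ _) quad_delta. Qed.

(* Testing on [e_i - (M i j)^* e_j] gives [-2 |M i j|^2 >= 0]. *)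
Lemma psdmx_diag_eq0 n (M : 'M[C]_n) :
  psdmx M -> (forall i, M i i = 0) -> M = 0.
Proof.
move=> [/hermsymmxP hM pM] M0; apply/matrixP=> i j; rewrite [RHS]mxE.
have hij : M j i = (M i j)^* by rewrite -[in LHS]hM !mxE.
pose c := - (M i j)^*.
have cc : c^* = - M i j by rewrite /c rmorphN /= conjCK.
have := pM (delta_mx i 0 + c *: delta_mx j 0).
rewrite trmxCD trmxCZ !trmx_delta !map_delta_mx !mulmxDl !mulmxDr.
rewrite -!scalemxAl -!scalemxAr -!rowE -!colE !mxE !M0 hij.
rewrite cc /c !mulr0 add0r addr0 !mulNr (mulrC _^*).
rewrite -opprD oppr_ge0 -normCK -mulr2n pmulrn_lle0 // => Mij.
by apply/eqP; rewrite -normr_eq0 -sqrf_eq0 eq_le Mij exprn_ge0.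
Qed.

Lemma psdmx_tr_eq0 n (M : 'M[C]_n) : psdmx M -> \tr M = 0 -> M = 0.
Proof.
move=> pM trM; apply: psdmx_diag_eq0 => // i.
by apply: (psumr_eq0P _ trM) => // j _; apply: psdmx_diag_ge0.
Qed.

Lemma psdmx_quad_gt0 n (M : 'M[C]_n) :
  psdmx M -> M != 0 -> exists v, 0 < complex.Re (quad M v).
Proof.
move=> pM; apply: contra_neqP => nM; apply: psdmx_diag_eq0 => // i.
apply/eqP; apply: contrapT => /negP Mii; apply: nM; exists (delta_mx i 0).
rewrite quad_delta -ltcR RRe_real ?ger0_real ?psdmx_diag_ge0 //.
by rewrite lt_def Mii psdmx_diag_ge0.
Qed.

(** Otherwise [M] would be psd with trace zero, hence zero. *)
Lemma herm_tr0_quad_lt0 n (M : 'M[C]_n) :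
  M \is hermsymmx -> \tr M = 0 -> M != 0 -> exists v, complex.Re (quad M v) < 0.
Proof.
move=> hM trM; apply: contra_neqP => nM; apply: psdmx_tr_eq0 => //.
apply/psdmxP; split=> // v; rewrite leNgt; apply/negP => Mv.
by apply: nM; exists v.
Qed.

End Hermitian.

(** * Blocks and partial trace of a matrix on a tensor product *)

Section Blocks.
Variables (R : realType) (k m : nat).
Local Notation C := R[i].
Implicit Types (A : 'M[C]_(k * m)) (X : 'M[C]_k) (Y G H : 'M[C]_m).

Definition blk A i j : 'M[C]_m :=
  \matrix_(p, q) A (mxtens_index (i, p)) (mxtens_index (j, q)).

Definition ptrace A : 'M[C]_m := \sum_i blk A i i.

Lemma blkP A B : (forall i j, blk A i j = blk B i j) -> A = B.
Proof.
move=> AB; apply/matrixP=> s t.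
case: (mxtens_indexP s) => i p; case: (mxtens_indexP t) => j q.
by have /matrixP/(_ p q) := AB i j; rewrite !mxE.
Qed.

Lemma blk_tens X Y i j : blk (X *t Y) i j = X i j *: Y.
Proof. by apply/matrixP=> p q; rewrite mxE tensmxE mxE. Qed.

Lemma blkD A B i j : blk (A + B) i j = blk A i j + blk B i j.
Proof. by apply/matrixP=> p q; rewrite !mxE. Qed.

Lemma blk_tens2 X1 X2 Y1 Y2 i j :
  blk (X1 *t Y1 + X2 *t Y2) i j = X1 i j *: Y1 + X2 i j *: Y2.
Proof. by rewrite blkD !blk_tens. Qed.

Lemma blk_trmxC A i j : A \is hermsymmx -> (blk A i j)^t* = blk A j i.
Proof.
by move=> /hermsymmxP hA; apply/matrixP=> p q; rewrite -[in RHS]hA !mxE.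
Qed.

Lemma ptrace_tens2 X1 X2 Y1 Y2 :
  ptrace (X1 *t Y1 + X2 *t Y2) = \tr X1 *: Y1 + \tr X2 *: Y2.
Proof.
rewrite /ptrace; under eq_bigr => i _ do rewrite blk_tens2.
by rewrite big_split /= -!scaler_suml.
Qed.

Lemma sum_delta_blk A : A = \sum_i \sum_j delta_mx i j *t blk A i j.
Proof.
apply/matrixP=> s t; case: (mxtens_indexP s) => i p.
case: (mxtens_indexP t) => j q; rewrite summxE (bigD1 i) //= summxE.
rewrite (bigD1 j) //= !big1 ?addr0 => [|i' ni|j' nj].
- by rewrite tensmxE !mxE !eqxx mul1r.
- rewrite summxE big1 // => j' _.
  by rewrite tensmxE mxE eq_sym (negPf ni) mul0r.
- by rewrite tensmxE mxE [j == _]eq_sym (negPf nj) andbF mul0r.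
Qed.

(** The diagonal block is the compression of [A] to the vectors [e_i *t w], so it inherits
    positivity from [A]. *)
Lemma quad_blk A i (w : 'cV_m) :
  quad (blk A i i) w = quad A ((delta_mx i 0 : 'cV_k) *t w).
Proof.
rewrite [in RHS](sum_delta_blk A) quad_sum (bigD1 i) //= quad_sum (bigD1 i) //=.
rewrite !big1 ?addr0 => [|i' ni|j nj].
- by rewrite quad_tens quad_delta mxE !eqxx mul1r.
- rewrite quad_sum big1 // => j _.
  by rewrite quad_tens quad_delta mxE eq_sym (negPf ni) mul0r.
- by rewrite quad_tens quad_delta mxE [i == j]eq_sym (negPf nj) andbF mul0r.
Qed.

Lemma psdmx_blk A i : psdmx A -> psdmx (blk A i i).
Proof.
move=> [hA pA]; split; first by apply/hermsymmxP; rewrite blk_trmxC.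
by move=> w; rewrite -/(quad _ _) quad_blk; apply: pA.
Qed.

Lemma psdmx_ptrace A : psdmx A -> psdmx (ptrace A).
Proof.
move=> pA; split=> [|w]; last first.
  rewrite -/(quad _ _) quad_sum; apply: sumr_ge0 => i _.
  by case: (psdmx_blk i pA) => _; apply.
have [hA _] := pA; apply/hermsymmxP; rewrite /ptrace linear_sum map_mx_sum.
by apply: eq_bigr => i _; rewrite blk_trmxC.
Qed.

(** Each diagonal entry of the partial trace is a sum of nonnegative diagonal entries of [A], so all
    of these vanish. *)
Lemma ptrace_eq0 A : psdmx A -> ptrace A = 0 -> A = 0.
Proof.
move=> pA G0; apply: psdmx_diag_eq0 => // s.
case: (mxtens_indexP s) => i p.
have /matrixP/(_ p p) := G0; rewrite summxE [RHS]mxE => /psumr_eq0P.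
have -> : A (mxtens_index (i, p)) (mxtens_index (i, p)) = blk A i i p p.
  by rewrite mxE.
by apply=> // j _; apply/psdmx_diag_ge0/psdmx_blk.
Qed.

(** * Bilinearity of the Kronecker product and tensor rank 2 *)

Lemma tensmxDl X1 X2 Y : (X1 + X2) *t Y = X1 *t Y + X2 *t Y.
Proof. by apply/blkP=> i j; rewrite blkD !blk_tens mxE scalerDl. Qed.

Lemma tensmxDr X Y1 Y2 : X *t (Y1 + Y2) = X *t Y1 + X *t Y2.
Proof. by apply/blkP=> i j; rewrite blkD !blk_tens scalerDr. Qed.

Lemma tensmxZ (c : C) X Y : (c *: X) *t Y = X *t (c *: Y).
Proof. by apply/blkP=> i j; rewrite !blk_tens mxE scalerA mulrC. Qed.

Lemma rank2_not_tens A X Y : has_tensor_rank A 2 -> A <> X *t Y.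
Proof.
move=> [_ minA] AXY.
suff: (2 <= 1)%N by [].
apply: (minA 1 (fun=> X) (fun=> Y)).
by rewrite /tensor_decomposition big_ord1.
Qed.

Lemma free2N (V : vectType C) (u v : V) :
  ~~ free [:: u; v] -> exists w a b, u = a *: w /\ v = b *: w.
Proof.
rewrite free_cons seq1_free span_seq1 negb_and !negbK.
case/orP=> [/vlineP[c ->]|/eqP->]; first by exists v, c, 1; rewrite scale1r.
by exists u, 1, 0; rewrite scale1r scale0r.
Qed.

(** If one pair of factors consisted of multiples of a common matrix, the two terms would merge into
    one elementary tensor. *)
Lemma rank2_free A X1 X2 Y1 Y2 :
  has_tensor_rank A 2 -> A = X1 *t Y1 + X2 *t Y2 ->
  free [:: X1; X2] /\ free [:: Y1; Y2].
Proof.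
move=> rA AE; split; apply: contrapT => /negP /free2N[w [a [b [Ea Eb]]]];
  apply: (rank2_not_tens rA); rewrite AE Ea Eb.
- by rewrite !tensmxZ -tensmxDr.
- by rewrite -!tensmxZ -tensmxDl.
Qed.

Lemma span2P (V : vectType C) (u v w : V) :
  w \in <<[:: u; v]>>%VS -> exists a b, w = a *: u + b *: v.
Proof.
rewrite span_cons span_seq1 => /memv_addP[x /vlineP[a ->]] [y /vlineP[b ->] ->].
by exists a, b.
Qed.

Lemma free2_eq (V : vectType C) (u v : V) a b c d :
  free [:: u; v] -> a *: u + b *: v = c *: u + d *: v -> a = c /\ b = d.
Proof.
move=> /(@freeP _ _ 2 [tuple u; v]) fuv /eqP.
rewrite -subr_eq0 opprD addrACA -!scalerBl => /eqP E.
pose f (i : 'I_2) := if i == 0 then a - c else b - d.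
have f0 : forall i, f i = 0.
  by apply: fuv; rewrite big_ord_recl big_ord1.
by have := (f0 0, f0 1); rewrite /f /= => -[/subr0_eq-> /subr0_eq->].
Qed.

Lemma tens2_span X1 X2 Y1 Y2 G H :
  Y1 \in <<[:: G; H]>>%VS -> Y2 \in <<[:: G; H]>>%VS ->
  exists Z1 Z2, X1 *t Y1 + X2 *t Y2 = Z1 *t G + Z2 *t H.
Proof.
move=> /span2P[a [b ->]] /span2P[c [d ->]].
exists (a *: X1 + c *: X2), (b *: X1 + d *: X2).
by rewrite !tensmxDr !tensmxDl !tensmxZ addrACA.
Qed.

(** If every block were a multiple of [G], the coefficients would form a matrix whose tensor product
    with [G] is [A]. *)
Lemma blk_notin_vline A (G : 'M[C]_m) :
  has_tensor_rank A 2 -> exists i j, blk A i j \notin <[G]>%VS.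
Proof.
move=> rA; apply: contrapT => nA.
pose c i j := coord [tuple G] 0 (blk A i j).
apply: (@rank2_not_tens A (\matrix_(i, j) c i j) G rA); apply/blkP => i j.
rewrite blk_tens mxE /c.
have /coord_span : blk A i j \in <<[tuple G]>>%VS.
  rewrite span_seq1; by apply: contrapT => /negP nG; apply: nA; exists i, j.
by rewrite big_ord1.
Qed.

Lemma herm_notin_vline (V : {vspace 'M[C]_m}) (M G : 'M[C]_m) :
  M \in V -> M^t* \in V -> M \notin <[G]>%VS ->
  exists H, [/\ H \is hermsymmx, H \in V & H \notin <[G]>%VS].
Proof.
move=> MV MV' MG.
have hD : M + M^t* \is hermsymmx.
  by apply/hermsymmxP; rewrite trmxCD trmxCK addrC.
have hB : 'i *: (M - M^t*) \is hermsymmx.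
  apply/hermsymmxP; rewrite trmxCZ trmxCD trmxCN trmxCK conjCi.
  by rewrite scaleNr -scalerN opprD opprK addrC.
have [DG|DG] := boolP (M + M^t* \in <[G]>%VS); last first.
  by exists (M + M^t*); split=> //; apply: memvD.
exists ('i *: (M - M^t*)); split=> //; first by rewrite memvZ ?memvB.
apply: contraNN MG => iBG.
have BG : M - M^t* \in <[G]>%VS.
  by rewrite -[_ - _]scale1r -(mulVf (neq0Ci _)) -scalerA memvZ.
suff -> : M = 2^-1 *: ((M + M^t*) + (M - M^t*)) by apply: memvZ; apply: memvD.
rewrite addrACA subrr addr0 -mulr2n -(scaler_nat _ M) scalerA.
by rewrite mulVf ?scale1r ?pnatr_eq0.
Qed.

(* The span of the second factors contains all blocks of [A], hence is stable
   under conjugate transposition and has a hermitian basis. *)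
Lemma herm_decomposition A :
  psdmx A -> has_tensor_rank A 2 ->
  exists X1 X2 H,
    [/\ X1 \is hermsymmx, X2 \is hermsymmx & H \is hermsymmx] /\
    [/\ A = X1 *t ptrace A + X2 *t H, free [:: ptrace A; H] & \tr X2 = 0].
Proof.
move=> pA rA; have [hA _] := pA.
have [[X [Y]]] := rA; rewrite /tensor_decomposition big_ord_recl big_ord1.
move: (X _) (X _) (Y _) (Y _) => U2 U1 Y2 Y1 AE _.
have [_ fY] := rank2_free rA AE.
set V := <<[:: Y1; Y2]>>%VS.
have blkV i j : blk A i j \in V.
  by rewrite AE blk_tens2 memvD // memvZ // memv_span // !inE eqxx ?orbT.
have GV : ptrace A \in V by apply: memv_suml => i _; apply: blkV.
have G0 : ptrace A != 0.
  apply/eqP=> G0; apply: (@rank2_not_tens A 0 0 rA).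
  by rewrite tens0mx; apply: ptrace_eq0.
have [i [j Mij]] := blk_notin_vline (ptrace A) rA.
have [] := herm_notin_vline (blkV i j) _ Mij; first by rewrite blk_trmxC.
move=> H [hH HV HG].
have fGH : free [:: ptrace A; H].
  rewrite (@perm_free _ _ _ [:: H; ptrace A]).
    by rewrite free_cons span_seq1 HG seq1_free G0.
  by rewrite (perm_catC [:: _] [:: _]).
(* Both spans have dimension 2, so one inclusion is enough. *)
have VE : V = <<[:: ptrace A; H]>>%VS.
  have dV : \dim V = 2 := eqP fY.
  apply/esym/eqP; rewrite eqEdim dV (eqP fGH) leqnn andbT.
  by apply/span_subvP=> M; rewrite !inE => /orP[]/eqP->.
have [||X1 [X2 AE']] := @tens2_span U1 U2 Y1 Y2 (ptrace A) H.
- by rewrite -VE memv_span // inE eqxx.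
- by rewrite -VE memv_span // !inE eqxx orbT.
rewrite -AE in AE'.
have hG : (ptrace A)^t* = ptrace A.
  by apply/hermsymmxP; case: (psdmx_ptrace pA).
(* Block [(p, q)] of [A] is the conjugate transpose of block [(q, p)]; as [G] and [H] are hermitian
   and independent, coefficients can be compared. *)
have hX p q : (X1 q p)^* = X1 p q /\ (X2 q p)^* = X2 p q.
  apply: (free2_eq fGH); rewrite -blk_tens2 -AE' -(blk_trmxC q p hA).
  by rewrite [in RHS]AE' blk_tens2 trmxCD !trmxCZ hG (hermsymmxP _ hH).
exists X1, X2, H; split; split=> //.
- by apply/hermsymmxP/matrixP => p q; rewrite !mxE; case: (hX p q).
- by apply/hermsymmxP/matrixP => p q; rewrite !mxE; case: (hX p q).
(* The partial trace of the decomposition reads [G = \tr X1 *: G + \tr X2 *: H], which forces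
   [\tr X2 = 0]. *)
have /(congr1 ptrace) := AE'; rewrite ptrace_tens2.
rewrite -[LHS]scale1r -[LHS]addr0 -(scale0r H).
by case/(free2_eq fGH).
Qed.

End Blocks.

Theorem theorem4p7 (R : realType) (k m : nat) (A : 'M[R[i]]_(k * m)) :
  psdmx A -> has_tensor_rank A 2 ->
  (exists (C1 C2 : 'M[R[i]]_k) (D1 D2 : 'M[R[i]]_m),
      [/\ psdmx C1, psdmx C2, psdmx D1 & psdmx D2] /\
      [/\ A = C1 *t D1 + C2 *t D2,
          free [:: C1; C2] & free [:: D1; D2]]) /\
  separable A.
Proof.
move=> pA rA.
(* Independence of the factors follows from rank 2, so only psd factors remain to be found. *)
have [C1 [C2 [D1 [D2 [[pC1 pC2 pD1 pD2] AE]]]]] :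
    exists (C1 C2 : 'M[R[i]]_k) (D1 D2 : 'M[R[i]]_m),
      [/\ psdmx C1, psdmx C2, psdmx D1 & psdmx D2] /\
      A = C1 *t D1 + C2 *t D2; last first.
  have [fC fD] := rank2_free rA AE; split; first by exists C1, C2, D1, D2.
  exists 2, (fun i => if i == 0 then C1 else C2).
  exists (fun i => if i == 0 then D1 else D2).
  split; last by move=> i; case: ifP.
  by rewrite /tensor_decomposition big_ord_recl big_ord1.
have [X1 [X2 [H [[hX1 hX2 hH]]]]] := herm_decomposition pA rA.
set G := ptrace A => -[AE fGH trX2].
have pG : psdmx G by apply: psdmx_ptrace.
have [hG qG] := (psdmxP G).1 pG.
have nG : exists w, 0 < complex.Re (quad G w).
  apply: psdmx_quad_gt0 pG _; apply: free_not0 fGH _; exact: mem_head.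
have nX2 : X2 != 0.
  apply/eqP=> X20; apply: (@rank2_not_tens _ _ _ A X1 G rA).
  by rewrite [LHS]AE X20 tens0mx addr0.
have pAq v w : 0 <= complex.Re (quad X1 v) * complex.Re (quad G w) +
                    complex.Re (quad X2 v) * complex.Re (quad H w).
  rewrite -ler0c rmorphD !rmorphM /= !quad_Re // -!quad_tens -quadD -AE.
  by case: pA => _; apply.
have [v ltv] := herm_tr0_quad_lt0 hX2 trX2 nX2.
(* [- X2] is also traceless and nonzero, so the form of [X2] takes a positive value at [v']. *)
have [||v' ltv'] := herm_tr0_quad_lt0 (hermZ (-1) hX2).
- by rewrite linearZ /= trX2 mulr0.
- by rewrite scaler_eq0 negb_or nX2 andbT rmorphN1 oppr_eq0 oner_eq0.
have [b [Hb Xb]] := separating_slope qG nG pAq (ex_intro _ v ltv).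
(* Changing the signs of both [X2] and [H] preserves [pAq] and yields the bound [- H <= a G]. *)
have [||a [Ha Xa]] := @separating_slope R _ _
  (fun v => complex.Re (quad X1 v)) (fun v => - complex.Re (quad X2 v))
  (fun w => complex.Re (quad G w)) (fun w => - complex.Re (quad H w)) qG nG.
- by move=> x y; rewrite mulrNN.
- by exists v'; rewrite -mulN1r -Re_quadZ.
have ab0 : 0 < a + b.
  rewrite lt_def; apply/andP; split; last first.
    case: nG => w Gw; rewrite -(pmulr_lge0 _ Gw).
    by have := Ha w; have := Hb w; lra.
  (* If [a = - b], the form of [b G - H] is both nonnegative and nonpositive, so [H = b G], against
     independence. *)
  apply/eqP => ab; have aE : a = - b by lra.
  have N0 : b%:C%C *: G + (-1)%:C%C *: H = 0.
    apply: contrapT => /eqP; have pN : psdmx (b%:C%C *: G + (-1)%:C%C *: H).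
      apply/psdmxP; split=> [|w]; first exact: hermD (hermZ _ hG) (hermZ _ hH).
      by rewrite Re_quadD !Re_quadZ; have := Hb w; lra.
    case/(psdmx_quad_gt0 pN) => w; rewrite Re_quadD !Re_quadZ.
    by have := Ha w; rewrite aE; lra.
  have [_ N1] : b%:C%C = 0 :> R[i] /\ (-1)%:C%C = 0 :> R[i].
    by apply: (free2_eq fGH); rewrite N0 !scale0r addr0.
  by have /= := congr1 (fun z : R[i] => complex.Re z) N1; lra.
pose c := (a + b)^-1.
have c_ge0 : 0 <= c by rewrite invr_ge0 ltW.
have cab : c%:C%C * (a%:C%C + b%:C%C) = 1.
  by rewrite -rmorphD -rmorphM mulVf ?rmorph1 // gt_eqF.
(* Every scalar, even [-1], is an embedded real, so that [hermZ] and [Re_quadZ] apply. *)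
exists (X1 + b%:C%C *: X2), (X1 + (- a)%:C%C *: X2).
exists (c%:C%C *: (H + a%:C%C *: G)).
exists (c%:C%C *: (b%:C%C *: G + (-1)%:C%C *: H)).
split; last first.
  (* On expansion the terms in [X1 *t H] and [X2 *t G] cancel, and the other two carry the factor
     [c (a + b) = 1]. *)
  apply/blkP => i j; rewrite [in LHS]AE !blk_tens2; apply/matrixP => p q.
  by rewrite !mxE !rmorphN rmorph1 /= -[LHS]mul1r -{1}cab; ring.
split; apply/psdmxP; split=> [|w].
- exact: hermD hX1 (hermZ _ hX2).
- by rewrite Re_quadD Re_quadZ.
- exact: hermD hX1 (hermZ _ hX2).
- by rewrite Re_quadD Re_quadZ; have := Xa w; lra.
- exact: hermZ _ (hermD hH (hermZ _ hG)).
- by rewrite Re_quadZ Re_quadD Re_quadZ mulr_ge0 //; have := Ha w; lra.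
- exact: hermZ _ (hermD (hermZ _ hG) (hermZ _ hH)).
- by rewrite Re_quadZ Re_quadD !Re_quadZ mulr_ge0 //; have := Hb w; lra.
Qed.
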